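(* Let $r,n,d$ be positive integers, $s=(r-1)\binom{n+d}{d}+1$, and $c,\alpha,\beta>0$. Let $\mathcal{F}$ be a hereditary family of strongly-algebraic $r$-uniform hypergraphs of complexity $(n,d)$. Suppose that each $\mathcal{H}\in\mathcal{F}$ on $N$ vertices contains either a clique of size at least $cN^{\alpha}$, or an independent set of size $s$. Then every $\mathcal{H}\in\mathcal{F}$ on $N$ vertices contains either a clique of size $c_1N^{\delta\alpha\beta/n}$, or an independent set of size at least $c_2N^{1-\beta}$, where $c_1,c_2>0$ depend only on the parameters $r,n,d,c,\alpha,\beta$, and $\delta=\delta(r)>0$ depends only on $r$.
   Context: For a set $V$, $V^{(r)}$ denotes the family of $r$-element subsets of $V$. An $r$-uniform hypergraph $\mathcal{H}$ is strongly-algebraic of complexity $(n,d)$ if its vertex set $V(\mathcal{H})$ is a subset of $\mathbb{F}^n$ for some field $\mathbb{F}$, and there exists a single polynomial $f:(\mathbb{F}^n)^r\to\mathbb{F}$ of degree at most $d$ such that $\{\mathbf{v}_1,\dots,\mathbf{v}_r\}\in V(\mathcal{H})^{(r)}$ is an edge if and only if $f(\mathbf{v}_1,\dots,\mathbf{v}_r)\neq 0$; it is assumed that the statement $f(\mathbf{v}_1,\dots,\mathbf{v}_r)=0$ is invariant under permutations of $\mathbf{v}_1,\dots,\mathbf{v}_r$. A family of $r$-uniform hypergraphs is hereditary if it is closed under taking induced subhypergraphs. A clique is a set of vertices all of whose $r$-element subsets are edges; an independent set is a set of vertices none of whose $r$-element subsets is an edge.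
   Formalization: The case r = 1 with β > 1 is excluded: there the claim fails, since for complete 1-uniform hypergraphs (c = α = 1) no non-empty independent set exists and c₁N^{δβ/n} exceeds N for large N once β > n/δ. *)

(* Defs.v *)
From mathcomp Require Import all_boot all_fingroup all_algebra finmap.
From mathcomp Require Import mpoly.

Set Implicit Arguments.
Unset Strict Implicit.
Unset Printing Implicit Defensive.

Import GRing.Theory.
Local Open Scope fset_scope.
Local Open Scope ring_scope.

Record hypergraph (T : choiceType) := Hypergraph {
  vertices : {fset T};
  edges : {fset {fset T}};
  edges_sub : edges `<=` fpowerset vertices
}.

Section Hypergraph.
Variables (T : choiceType) (r : nat).
Implicit Types (H : hypergraph T) (A : {fset T}).

Definition uniform H : Prop := forall e, e \in edges H -> #|` e| = r.

Definition clique H A : Prop :=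
  A `<=` vertices H /\
  (forall e : {fset T}, e `<=` A -> #|` e| = r -> e \in edges H).

Definition independent H A : Prop :=
  A `<=` vertices H /\
  (forall e : {fset T}, e `<=` A -> #|` e| = r -> e \notin edges H).

Definition induced_subhypergraph H' H : Prop :=
  vertices H' `<=` vertices H /\
  edges H' = [fset e in edges H | e `<=` vertices H'].

End Hypergraph.

(* A polynomial map (K^n)^r -> K is a polynomial in r * n variables; it is
   evaluated at the row-major concatenation of the vectors v_0, ..., v_(r-1). *)
Definition eval_vectors (K : fieldType) (r n : nat)
    (f : {mpoly K[r * n]}) (v : 'I_r -> 'rV[K]_n) : K :=
  f.@[fun k => mxvec (\matrix_(i < r) v i) 0 k].

(* [msize f] is one more than the total degree of [f] (and 0 for [f = 0]).
   The invariance of the zero set is required on all of (K^n)^r. *)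
Definition strongly_algebraic (K : fieldType) (r n d : nat)
    (H : hypergraph 'rV[K]_n) : Prop :=
  exists f : {mpoly K[r * n]},
    [/\ (msize f <= d.+1)%N,
        forall (p : 'S_r) (v : 'I_r -> 'rV[K]_n),
          eval_vectors f (v \o p) = 0 <-> eval_vectors f v = 0
      & forall v : 'I_r -> 'rV[K]_n,
          injective v -> (forall i, v i \in vertices H) ->
          ([fset v i | i in 'I_r] \in edges H) <-> eval_vectors f v <> 0].

(* The field is allowed to vary among the members of a family. *)
Definition hypergraph_family (n : nat) :=
  forall K : fieldType, hypergraph 'rV[K]_n -> Prop.

Definition hereditary (n : nat) (F : hypergraph_family n) : Prop :=
  forall (K : fieldType) (H H' : hypergraph 'rV[K]_n),
    F K H -> induced_subhypergraph H' H -> F K H'.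

(* Main.v *)
Require Import Defs.
From mathcomp Require Import all_boot all_order all_algebra finmap.
From mathcomp Require Import reals exp.
From mathcomp Require Import mpoly zify ring lra.

(** Write D = 'C(n + d, d) for the dimension of the space of polynomials of
    degree at most d in n variables; two facts about this space drive the
    argument.  First, if polynomials p_i and points w_i satisfy p_i(w_i) <> 0,
    and p_i(w_j) = 0 for all j beyond i, then the p_i are linearly independent,
    so there are at most D of them ([algebraic_set_dim]).  Secondly, applied to
    products of m such polynomials, the same fact bounds the number of zero
    patterns that m polynomials realize by roughly m ^ n ([card_avoided]).

    The heart of the proof is a one-sided regularity statement
    ([homogeneous_sample]).  Let q be about N ^ (beta / (n (r + 1))).  Then
    there are q distinct vertices u_1, ..., u_q, and around each u_i a cluster
    W_i of at least N ^ (1 - beta) vertices, such that as soon as f vanishes at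
    (u_{i_1}, ..., u_{i_r}), with distinct indices, it vanishes on the whole of
    W_{i_1} x ... x W_{i_r}.  The cluster of x consists of the points lying in
    every set T of a list TT of test sets that contains x.  Each test set is an
    intersection of zero loci of polynomials obtained from f by fixing all but
    one vector.  The list is built one coordinate of f at a time.  Test sets
    are added greedily while some candidate test set containing x still cuts
    the cluster of x, for many x; by the first fact this happens at most D
    times for each x, so about q ^ r test sets suffice to make the proportion
    of exceptional r-tuples smaller than q ^ (- r) ([greedy_tests],
    [exists_tests]).  By the second fact there are then about q ^ (r n)
    clusters, hence few vertices have a small one.  A union bound over random
    u_1, ..., u_q finishes.

    If f vanishes on all of W_i ^ r for some i, then W_i is the required
    independent set.  Otherwise U = {u_1, ..., u_q} has no independent set with (r - 1) D + 1
    elements ([card_empty_clusters]).  Indeed, let S index an independent set,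
    so that f vanishes on products of distinct clusters indexed by S.  Starting
    from an r-tuple in W_i where f is nonzero, move coordinates one by one from
    W_i to clusters not yet met, as long as f stays nonzero.  This must stop
    while two coordinates are still in W_i, and freeing one of them gives a
    polynomial which is nonzero somewhere on W_i, but vanishes on all but r - 1
    of the clusters, W_i being among those r - 1 ([cluster_test]).  If S had
    more than (r - 1) D elements, D + 1 of these polynomials could be chosen
    triangular with respect to points of their clusters
    ([acyclic_selection]), against the first fact.

    So the subhypergraph induced on U falls under the first alternative of the
    hypothesis: it has a clique of size c q ^ alpha, which is a clique of H of
    the required size with delta = 1 / (r + 1). *)

Set Implicit Arguments.
Unset Strict Implicit.
Unset Printing Implicit Defensive.

Import Order.TTheory GRing.Theory Num.Theory.
Local Open Scope ring_scope.

(** * Polynomials of bounded degree *)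

(** A monomial is coded by its tuple of exponents. *)
Lemma card_bmultinom_le n d : (#|{: 'X_{1..n < d.+1}}| <= 'C(n + d, n))%N.
Proof.
pose f (m : 'X_{1..n < d.+1}) : n.-tuple 'I_d.+1 :=
  [tuple inord ((m : 'X_{1..n}) i) | i < n].
have le_md (m : 'X_{1..n < d.+1}) i : ((m : 'X_{1..n}) i < d.+1)%N.
  apply: leq_ltn_trans (bmdeg m); rewrite mdegE (bigD1 i) //=; exact: leq_addr.
have f_inj : injective f.
  move=> m1 m2 eq_f; apply/val_inj/mnmP => i.
  have /(congr1 val) := congr1 (fun t => tnth t i) eq_f.
  by rewrite !tnth_mktuple /= !inordK.
rewrite -card_partial_ord_partitions -(card_codom f_inj).
apply: subset_leq_card; apply/subsetP => t /codomP [m ->]; rewrite inE.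
rewrite big_tuple (eq_bigr (fun i => (m : 'X_{1..n}) i)).
  by rewrite -mdegE -ltnS bmdeg.
by move=> i _; rewrite tnth_mktuple inordK.
Qed.

(** The sharp degree bound for a product, with both degrees shifted by one;
    the case of a zero factor is the reason for stating it with inequalities. *)
Lemma msizeM_degree (K : fieldType) n a b (p q : {mpoly K[n]}) :
  (msize p <= a.+1 -> msize q <= b.+1 -> msize (p * q) <= (a + b).+1)%N.
Proof.
have [->|p0] := eqVneq p 0; first by rewrite mul0r msize0.
have [->|q0] := eqVneq q 0; first by rewrite mulr0 msize0.
rewrite msizeM //; move: (msize p) (msize q); lia.
Qed.

Section AlgebraicSets.
Variables (K : fieldType) (n : nat) (X : finType) (pt : X -> 'I_n -> K).

(** The trace on X of an intersection of zero loci of polynomials of degree at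
    most d: each point outside the set is separated from it by one of them. *)
Definition algebraic_set (d : nat) (A : {set X}) : Prop :=
  forall x, x \notin A -> exists p : {mpoly K[n]},
    [/\ (msize p <= d.+1)%N, p.@[pt x] != 0
      & forall w, w \in A -> p.@[pt w] = 0].

(** Separate each w i from A i by a polynomial.  The matrix of values of these
    polynomials at the points w j is triangular for the order given by h, with
    nonzero diagonal entries, and it factors through the space of polynomials
    of degree at most d. *)
Lemma algebraic_set_dim d (I : finType) (h : I -> nat)
    (A : I -> {set X}) (w : I -> X) :
    (forall i, algebraic_set d (A i)) -> (forall i, w i \notin A i) ->
    (forall i j, i != j -> (h i <= h j)%N -> w j \in A i) ->
  (#|I| <= 'C(n + d, n))%N.
Proof.
move=> algA wNA wA.
have /fin_all_exists [p pP] (i : I) : exists p : {mpoly K[n]},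
    [/\ (msize p <= d.+1)%N, p.@[pt (w i)] != 0
      & forall x, x \in A i -> p.@[pt x] = 0] by exact: algA.
apply: leq_trans (card_bmultinom_le n d).
pose P := \matrix_(i < #|I|, k < #|{: 'X_{1..n < d.+1}}|)
  (p (enum_val i))@_(enum_val k : 'X_{1..n < d.+1}).
pose E := \matrix_(k < #|{: 'X_{1..n < d.+1}}|, j < #|I|)
  ('X_[(enum_val k : 'X_{1..n < d.+1})] : {mpoly K[n]}).@[pt (w (enum_val j))].
have PE i j : (P *m E) i j = (p (enum_val i)).@[pt (w (enum_val j))].
  have [szp _ _] := pP (enum_val i).
  rewrite [in RHS](mpolywE szp) raddf_sum /= mxE.
  rewrite [RHS](reindex (enum_val : 'I_#|{: 'X_{1..n < d.+1}}| -> _)) /=.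
    by apply: eq_bigr => k _; rewrite !mxE mevalZ.
  by apply: onW_bij; exact: enum_val_bij.
suff : row_free (P *m E).
  rewrite /row_free => /eqP rk; rewrite -{1}rk.
  exact: leq_trans (mulmx_max_rank _ _) (leqnn _).
apply/inj_row_free => u uG; apply/eqP/negPn/negP => /rV0Pn [i0 ui0].
(* The column of a support index j of maximal height only sees u 0 j. *)
pose j := [arg max_(j > i0 | u 0 j != 0) h (enum_val j)].
have [uj jmax] : u 0 j != 0 /\
    forall i, u 0 i != 0 -> (h (enum_val i) <= h (enum_val j))%N.
  by rewrite /j; case: arg_maxnP => //.
have /eqP := congr1 (fun v : 'rV_#|I| => v 0 j) uG; rewrite mxE [X in _ == X]mxE.
rewrite (bigD1 j) //= big1 ?addr0 => [|i ij].
  by rewrite PE mulf_eq0 (negPf uj); case: (pP (enum_val j)) => _ /negPf ->.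
have [->|ui] := eqVneq (u 0 i) 0; first by rewrite mul0r.
rewrite PE; case: (pP (enum_val i)) => _ _ -> ; first by rewrite mulr0.
by apply: wA; [rewrite (inj_eq enum_val_inj) | exact: jmax].
Qed.

(** Products of separating polynomials separate from the union. *)
Lemma algebraic_setU d e A B :
  algebraic_set d A -> algebraic_set e B -> algebraic_set (d + e)%N (A :|: B).
Proof.
move=> algA algB x; rewrite inE negb_or => /andP [/algA [p [szp px pA]]].
case/algB => q [szq qx qB]; exists (p * q); split.
- exact: msizeM_degree.
- by rewrite mevalM mulf_neq0.
- by move=> w; rewrite inE mevalM => /orP [/pA|/qB] ->; rewrite (mul0r, mulr0).
Qed.

Lemma algebraic_set_bigcup d (I : finType) (P : {set I}) (A : I -> {set X}) :
  (forall i, algebraic_set d (A i)) ->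
  algebraic_set (#|P| * d)%N (\bigcup_(i in P) A i).
Proof.
move=> algA; have [k le_k] := ubnP #|P|; elim: k P le_k => // k IH P le_k.
have [->|/set0Pn [i iP]] := eqVneq P set0.
  rewrite big_set0 cards0 => x _; exists 1; split=> [||w].
  - by rewrite msize1.
  - by rewrite meval1 oner_neq0.
  - by rewrite inE.
rewrite (bigD1 i) //= (eq_bigl (mem (P :\ i))) => [|j]; last first.
  by rewrite !inE andbC.
rewrite (cardsD1 i) iP mulSn; apply: algebraic_setU; first exact: algA.
by apply: IH; move: le_k; rewrite (cardsD1 i P) iP.
Qed.

Lemma algebraic_setS d e A : (d <= e)%N -> algebraic_set d A -> algebraic_set e A.
Proof.
move=> de algA x /algA [p [szp px pA]]; exists p; split=> //.
exact: leq_trans szp _.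
Qed.

(** The points that the test sets of TT cannot separate from x.  Only the tests
    that contain x are imposed, so this relation is not symmetric. *)
Definition hull (TT : seq {set X}) (x : X) : {set X} :=
  [set w | all (fun T : {set X} => (x \in T) ==> (w \in T)) TT].

Lemma hullP TT x w : reflect
  (forall T : {set X}, T \in TT -> x \in T -> w \in T) (w \in hull TT x).
Proof.
rewrite inE; apply: (iffP allP) => h T TTT; first exact/implyP/h.
by apply/implyP/h.
Qed.

Lemma hullS TT TT' x : {subset TT <= TT'} ->
  hull TT' x \subset hull TT x.
Proof.
move=> sTT; apply/subsetP => w /hullP cw; apply/hullP => T /sTT; exact: cw.
Qed.

(** The zero pattern of x with respect to the list of test sets. *)
Definition avoided (TT : seq {set X}) (x : X) : {set 'I_(size TT)} :=
  [set i : 'I_(size TT) | x \notin tnth (in_tuple TT) i].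

(** Choose a point for every pattern.  The union of the test sets avoided by
    this point is algebraic, and misses the points of another pattern only if
    that pattern is larger; so the points are in triangular position for these
    unions, ordered by decreasing size of the patterns. *)
Lemma card_avoided d (TT : seq {set X}) :
    (forall T, T \in TT -> algebraic_set d T) ->
  (#|[set avoided TT x | x : X]| <= 'C(n + size TT * d, n))%N.
Proof.
move=> algTT; set Q := [set _ | _ in _].
pose I : finType := {P | P \in Q}.
have /fin_all_exists [rep repP] (P : I) : exists x, avoided TT x = val P.
  by case: P => P /= /imsetP [x _ ->]; exists x.
have -> : #|Q| = #|I| by rewrite card_sig; apply: eq_card.
pose fails (P : I) := \bigcup_(i in val P) tnth (in_tuple TT) i.
apply: (@algebraic_set_dim (size TT * d)%N I (fun P => size TT - #|val P|)%N
  fails rep) => [P|P|P P' neqP].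
- apply: (@algebraic_setS (#|val P| * d)%N).
    by rewrite leq_mul2r (leq_trans (max_card _)) ?card_ord ?orbT.
  by apply: algebraic_set_bigcup => i; apply: algTT; exact: mem_tnth.
- apply/bigcupP => -[i]; rewrite -repP inE => /negPf -> //.
- move=> le_P; apply/negPn/negP => notin; move/negP: neqP; case; apply/eqP.
  have sPP : val P \subset val P'.
    apply/subsetP => i iP; rewrite -repP inE; apply: contra notin => iP'.
    by apply/bigcupP; exists i.
  apply/val_inj/eqP; rewrite eqEcard sPP.
  have le_size (Q' : {set 'I_(size TT)}) : (#|Q'| <= size TT)%N.
    by have := max_card (mem Q'); rewrite card_ord.
  move: le_P (le_size (val P)) (le_size (val P')).
  by move: #|val P| #|val P'|; lia.
Qed.

(** A hull contains all points with the same zero pattern as its base point, so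
    each pattern accounts for fewer than t points with a small hull. *)
Lemma card_small_hull d (TT : seq {set X}) t :
    (forall T, T \in TT -> algebraic_set d T) ->
  (#|[set x | #|hull TT x| < t]| <= 'C(n + size TT * d, n) * t)%N.
Proof.
move=> algTT; apply: leq_trans (leq_mul (card_avoided algTT) (leqnn t)).
set B := [set x | _]; rewrite -sum1_card.
rewrite (partition_big (avoided TT) (mem [set avoided TT x | x : X])) /=; last first.
  by move=> x _; apply: imset_f.
rewrite -sum_nat_const; apply: leq_sum => P _; rewrite sum1dep_card.
have [->|/set0Pn [x]] := eqVneq [set x | (x \in B) && (avoided TT x == P)] set0.
  by rewrite cards0.
rewrite !inE => /andP [/ltnW xt /eqP xP]; apply: leq_trans xt.
apply: subset_leq_card; apply/subsetP => w; rewrite inE => /andP [_ /eqP wP].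
apply/hullP => T /(tnthP (in_tuple TT)) [i ->] xT; apply/negPn/negP => wT.
have: i \in avoided TT w by rewrite inE.
by rewrite wP -xP inE xT.
Qed.

(** As long as some T y cuts the hull of many points x it contains, add it to S.
    For a fixed x the additions that cut the hull of x come with points in
    triangular position, so there are at most D = 'C(n + d, n) of them; double
    counting shows that one of the first m stages has no candidate left that
    cuts more than D #|X| / m hulls. *)
Lemma greedy_tests (Y : finType) d (T : Y -> {set X}) m :
    (0 < m)%N -> (forall y, algebraic_set d (T y)) ->
  exists S : seq Y, (size S <= m)%N /\ forall y,
    (m * #|[set x in T y | ~~ (hull [seq T z | z <- S] x \subset T y)]|
       <= 'C(n + d, n) * #|X|)%N.
Proof.
move=> m_gt0 algT; set D := 'C(n + d, n).
pose bad S y := [set x in T y | ~~ (hull [seq T z | z <- S] x \subset T y)].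
suff [S [szS goodS]] : exists S : seq Y, (size S <= m)%N /\
    [forall y, m * #|bad S y| <= D * #|X|]%N.
  by exists S; split=> // y; exact: (forallP goodS).
have [y0 _|Y0] := pickP Y; last first.
  by exists [::]; split=> //; apply/forallP => y; have := Y0 y.
pose next S := odflt y0 [pick y | D * #|X| < m * #|bad S y|]%N.
pose stage k := iter k (fun S => next S :: S) [::].
have sz_stage k : size (stage k) = k by elim: k => //= k ->.
have mem_stage k l : (k < l)%N -> next (stage k) \in stage l.
  elim: l => // l IH; rewrite ltnS leq_eqVlt => /predU1P [->|/IH kl].
    exact: mem_head.
  by rewrite inE kl orbT.
have le_D x : (\sum_(k < m) (x \in bad (stage k) (next (stage k))) <= D)%N.
  rewrite -big_mkcond sum1_card.
  set B := [pred k : 'I_m | x \in bad (stage k) (next (stage k))].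
  pose I : finType := {k | B k}.
  have /fin_all_exists [w wP] (k : I) : exists w,
      w \in hull [seq T z | z <- stage (val k)] x
      /\ w \notin T (next (stage (val k))).
    case: k => k /=; rewrite inE => /andP [_ /subsetPn [w]]; by exists w.
  have -> : #|B| = #|I| by rewrite card_sig; apply: eq_card.
  apply: (@algebraic_set_dim d I (fun k => val (val k))
      (fun k => T (next (stage (val k)))) w) => [k|k|k l neq_kl le_kl].
  - exact: algT.
  - by case: (wP k).
  - case: (wP l) => /hullP wl _; apply: wl.
      apply/map_f/mem_stage; rewrite ltn_neqAle le_kl andbT.
      by apply: contra neq_kl => /eqP kl; apply/eqP/val_inj/val_inj.
    by case: k {neq_kl le_kl} => k /=; rewrite inE => /andP [].
have [|nogood] := boolP [exists k : 'I_m,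
    [forall y, m * #|bad (stage k) y| <= D * #|X|]%N].
  by case/existsP => k goodk; exists (stage k); rewrite sz_stage ltnW.
have lt_bad (k : 'I_m) : (D * #|X| < m * #|bad (stage k) (next (stage k))|)%N.
  rewrite /next; case: pickP => //= nob.
  move/existsPn/(_ k)/forallPn: nogood => [y]; rewrite -ltnNge => lt_y.
  by have := nob y; rewrite /= lt_y.
have : (\sum_(k < m) #|bad (stage k) (next (stage k))| <= D * #|X|)%N.
  rewrite mulnC -sum_nat_const.
  rewrite (eq_bigr (fun k : 'I_m =>
    \sum_x (x \in bad (stage k) (next (stage k))))%N) => [|k _]; last first.
    by rewrite -big_mkcond sum1_card.
  by rewrite exchange_big; apply: leq_sum => x _; exact: le_D.
move/(fun le_sum => leq_mul (leqnn m) le_sum); rewrite big_distrr /= leqNgt.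
move=> /negP [].
have -> : (m * (D * #|X|) = \sum_(k < m) D * #|X|)%N.
  by rewrite sum_nat_const card_ord.
pose k0 := Ordinal m_gt0; rewrite (bigD1 k0) //= [X in (_ < X)%N](bigD1 k0) //=.
by rewrite -addSn leq_add ?(lt_bad k0) // leq_sum // => k _; exact: ltnW.
Qed.
End AlgebraicSets.

(** * Clusters and the regularity statement *)

Definition update (I : finType) (X : Type) (u : {ffun I -> X}) (i : I) (x : X) :
  {ffun I -> X} := [ffun j => if j == i then x else u j].

Lemma update_id (I : finType) X (u : {ffun I -> X}) i : update u i (u i) = u.
Proof. by apply/ffunP => j; rewrite ffunE; case: eqP => [->|]. Qed.

Lemma update_update (I : finType) X (u : {ffun I -> X}) i x x' :
  update (update u i x) i x' = update u i x'.
Proof. by apply/ffunP => j; rewrite !ffunE; case: eqP. Qed.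

(** Counting principle behind the union bound: if a property is rare for every
    conditioning on all coordinates but the i-th, then it is rare.  The map
    exchanging the i-th coordinate with an independent sample is an
    involution. *)
Lemma card_resample (I X : finType) (i : I) (P : pred {ffun I -> X}) a b :
    (forall u, a * #|[set x | P (update u i x)]| <= b * #|X|)%N ->
  (a * #|[set u | P u]| <= b * #|X| ^ #|I|)%N.
Proof.
move=> le_b.
have [X0|X_gt0] := posnP #|X|.
  rewrite [X in (a * X)%N](_ : _ = 0)%N ?muln0 //.
  apply/eqP; rewrite cards_eq0 -subset0; apply/subsetP => u _.
  by have := card0_eq X0 (u i); rewrite inE.
rewrite -(leq_pmul2r X_gt0).
pose swap (p : {ffun I -> X} * X) := (update p.1 i p.2, p.1 i).
have swapK : involutive swap.
  case=> u x; rewrite /swap /= ffunE eqxx; congr (_, _).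
  by apply/ffunP => j; rewrite !ffunE; case: eqP => [->|].
rewrite -mulnA.
have -> : (#|[set u | P u]| * #|X| = \sum_u #|[set x | P (update u i x)]|)%N.
  transitivity (\sum_(p : {ffun I -> X} * X) P p.1)%N.
    rewrite -(pair_bigA _ (fun u (x : X) => P u : nat)) /=.
    rewrite (eq_bigr (fun u => P u * #|X|))%N => [|u _].
      by rewrite -big_distrl /= -big_mkcond sum1dep_card.
    by rewrite sum_nat_const mulnC.
  rewrite (reindex_inj (inv_inj swapK)).
  rewrite -(pair_bigA _ (fun u x => P (update u i x) : nat)) /=.
  by apply: eq_bigr => u _; rewrite -big_mkcond sum1dep_card.
rewrite big_distrr /=.
have -> : (b * #|X| ^ #|I| * #|X| = \sum_(u : {ffun I -> X}) b * #|X|)%N.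
  by rewrite sum_nat_const card_ffun mulnCA mulnA.
by apply: leq_sum => u _; exact: le_b.
Qed.

Section Homogeneous.
Variables (K : fieldType) (n : nat) (X : finType) (pt : X -> 'I_n -> K).
Variables (r d : nat) (Z : pred {ffun 'I_r -> X}).
Hypothesis algZ : forall v k, algebraic_set pt d [set x | Z (update v k x)].
Local Notation D := 'C(n + d, n).

(** Z holds on the box whose first k sides are the hulls of the entries of y
    and whose other sides are these entries: the invariant that grows from a
    single zero, for k = 0, to a whole product of hulls, for k = r. *)
Definition zero_upto (TT : seq {set X}) (k : nat) (y : {ffun 'I_r -> X}) : bool :=
  [forall z : {ffun 'I_r -> X},
    [forall l : 'I_r,
      if (l < k)%N then z l \in hull TT (y l) else z l == y l] ==> Z z].

Lemma zero_uptoP TT k (y : {ffun 'I_r -> X}) : reflect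
  (forall z : {ffun 'I_r -> X},
     (forall l : 'I_r, if (l < k)%N then z l \in hull TT (y l) else z l == y l) ->
     Z z)
  (zero_upto TT k y).
Proof.
apply: (iffP forallP) => h z; first by move=> hz; exact/(implyP (h z))/forallP.
by apply/implyP => /forallP; exact: h.
Qed.

(** In its l-th argument, the box condition is a conjunction of instances of Z
    with the other arguments frozen. *)
Lemma algebraic_zero_upto TT y (l : 'I_r) :
  algebraic_set pt d [set x | zero_upto TT l (update y l x)].
Proof.
move=> x; rewrite inE => /forallPn [z]; rewrite negb_imply.
case/andP => /forallP hz nZ.
have zl : z l = x by have := hz l; rewrite ltnn ffunE eqxx => /eqP.
have [|p [szp px pA]] := algZ (v := z) (k := l) (x := x).
  by rewrite inE -zl update_id.
exists p; split=> // w; rewrite inE => /zero_uptoP hw; apply: pA; rewrite inE.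
apply: hw => j; have := hz j; rewrite !ffunE.
by have [->|//] := eqVneq j l; rewrite ltnn eqxx.
Qed.

(** One more coordinate is treated by adding the tests produced by
    [greedy_tests] for the sets of [algebraic_zero_upto].  Enlarging the list of
    tests shrinks all hulls, so what was gained for the first k coordinates is
    kept.  The bound is stated for tuples drawn from a random u : 'I_q -> X, so
    that it can be summed over all index tuples phi. *)
Lemma exists_tests q m k : (0 < m)%N -> (k <= r)%N ->
  exists TT : seq {set X},
    [/\ (size TT <= k * m)%N, forall T, T \in TT -> algebraic_set pt d T
      & forall phi : 'I_r -> 'I_q, injective phi ->
        (m * #|[set u : {ffun 'I_q -> X} |
                  Z [ffun l => u (phi l)] && ~~ zero_upto TT k [ffun l => u (phi l)]]|
         <= k * D * #|X| ^ q)%N].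
Proof.
move=> m_gt0; elim: k => [|k IH] k_lt.
  exists [::]; split=> // phi _; rewrite [X in (m * X)%N](_ : _ = 0)%N ?muln0 //.
  apply/eqP; rewrite cards_eq0 -subset0; apply/subsetP => u; rewrite inE.
  case/andP => Zu /zero_uptoP []; move=> z hz; congr (is_true (Z _)): Zu.
  by apply/ffunP => l; have /eqP := hz l.
have [TT [szTT algTT goodTT]] := IH (ltnW k_lt).
pose lk := Ordinal k_lt.
pose T (y : {ffun 'I_r -> X}) := [set x | zero_upto TT k (update y lk x)].
have algT y : algebraic_set pt d (T y).
  exact: (@algebraic_zero_upto TT y lk).
have [S [szS goodS]] := greedy_tests m_gt0 algT.
exists (TT ++ [seq T y | y <- S]); split.
- by rewrite size_cat size_map mulSn addnC leq_add.
- by move=> U; rewrite mem_cat => /orP [/algTT //|/mapP [y _ ->]].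
move=> phi phi_inj.
(* A new bad tuple has its k-th entry in a test set that cuts its hull. *)
pose y (u : {ffun 'I_q -> X}) : {ffun 'I_r -> X} := [ffun l => u (phi l)].
pose bad1 := [set u : {ffun 'I_q -> X} | Z (y u) && ~~ zero_upto TT k (y u)].
pose bad2 := [set u : {ffun 'I_q -> X} | (y u lk \in T (y u)) &&
  ~~ (hull [seq T y | y <- S] (y u lk) \subset T (y u))].
have sub : [set u : {ffun 'I_q -> X} | Z (y u) &&
    ~~ zero_upto (TT ++ [seq T y | y <- S]) k.+1 (y u)] \subset bad1 :|: bad2.
  apply/subsetP => u; rewrite !inE => /andP [Zu nE].
  rewrite Zu /=; case: (boolP (zero_upto TT k (y u))) => //= zu.
  rewrite update_id zu /=; apply: contra nE => /subsetP cl_sub.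
  apply/zero_uptoP => z hz.
  have := hz lk; rewrite /= ltnSn => zk.
  have /cl_sub : z lk \in hull [seq T y | y <- S] (y u lk).
    by apply: (subsetP (hullS _ _)) zk => U; rewrite mem_cat orbC => ->.
  rewrite inE => /zero_uptoP; apply=> l; rewrite !ffunE.
  have := hz l; rewrite ltnS leq_eqVlt !ffunE.
  have [->|ll] := eqVneq l lk; first by rewrite ltnn.
  rewrite (_ : (l : nat) == k = false) /=; last first.
    by apply: contraNF ll => /eqP lk'; apply/eqP/val_inj.
  case: ifP => // _; apply/subsetP/hullS => U; by rewrite mem_cat => ->.
apply: leq_trans (leq_mul (leqnn m) (subset_leq_card sub)) _.
apply: leq_trans (leq_mul (leqnn m) (leq_card_setU _ _)) _.
rewrite mulnDr mulSn mulnDl addnC leq_add ?goodTT //.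
rewrite -[X in (_ ^ X)%N](card_ord q).
apply: (@card_resample _ _ (phi lk)) => u.
rewrite (_ : [set x | _] =
  [set x in T (y u) | ~~ (hull [seq T y | y <- S] x \subset T (y u))]).
  exact: goodS.
have yE x : y (update u (phi lk) x) = update (y u) lk x.
  by apply/ffunP => l; rewrite !ffunE (inj_eq phi_inj).
have TE x : T (update (y u) lk x) = T (y u).
  by apply/setP => x'; rewrite [LHS]in_set [RHS]in_set update_update.
by apply/setP => x; rewrite [LHS]in_set [RHS]in_set yE TE ffunE eqxx.
Qed.

Lemma bin_le_exp a b : ('C(a, b) <= a ^ b)%N.
Proof.
have ffact_le c e : (c ^_ e <= c ^ e)%N.
  elim: e c => // e IH c; rewrite ffactnS expnS leq_mul2l.
  apply/orP; right; apply: leq_trans (IH _) _.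
  by case: e {IH} => // e; rewrite leq_exp2r // leq_pred.
apply: leq_trans (ffact_le a b); rewrite -bin_ffact leq_pmulr //; exact: fact_gt0.
Qed.

Lemma card_bigcup_le (I U : finType) (A : I -> {set U}) N b :
  (forall i, #|I| * (b * #|A i|) <= N)%N -> (b * #|\bigcup_i A i| <= N)%N.
Proof.
move=> le_N; have [I0|I_gt0] := posnP #|I|.
  rewrite big_pred0 ?cards0 ?muln0 // => i.
  by have := card0_eq I0 i.
rewrite -(leq_pmul2l I_gt0).
have -> : (#|I| * N = \sum_(i : I) N)%N by rewrite sum_nat_const.
apply: (@leq_trans (\sum_i #|I| * (b * #|A i|))%N); last first.
  by apply: leq_sum => i _; exact: le_N.
rewrite -big_distrr /= leq_mul2l; apply/orP; right.
rewrite -big_distrr /= leq_mul2l; apply/orP; right.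
elim/big_rec2: _ => [|i a B _ le_a]; first by rewrite cards0.
by apply: leq_trans (leq_card_setU _ _) _; rewrite leq_add2l.
Qed.

Lemma exists_notin_setU3 (U : finType) (A B C : {set U}) :
    (4 * #|A| <= #|U| -> 4 * #|B| <= #|U| -> 4 * #|C| <= #|U| -> 0 < #|U| ->
  exists u, u \notin A :|: B :|: C)%N.
Proof.
move=> leA leB leC U_gt0; apply/existsP; apply: contraT => none.
have le_U : (#|U| <= #|A :|: B :|: C|)%N.
  rewrite -cardsT; apply/subset_leq_card/subsetP => u _.
  by apply: contraR none => uP; apply/existsP; exists u.
have leAB : (#|A :|: B| <= #|A| + #|B|)%N := leq_card_setU _ _.
have leABC : (#|A :|: B :|: C| <= #|A :|: B| + #|C|)%N := leq_card_setU _ _.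
move: U_gt0 le_U leAB leABC leA leB leC.
by move: #|U| #|A| #|B| #|C| #|A :|: B| #|A :|: B :|: C|; lia.
Qed.

(** With m = 4 r D q ^ r tests for each of the r coordinates, n plus the
    degree of a product of one polynomial per test is at most this constant times q ^ r. *)
Definition regularity_constant := (n + 4 * r ^ 2 * d * D)%N.

(** Union bound for a random u : 'I_q -> X.  With probability at most 1/4 each:
    some index tuple is exceptional for the tests; u has a collision; some u i
    has a hull with fewer than t elements. *)
Lemma homogeneous_sample q t : (0 < r)%N -> (0 < q)%N ->
    (4 * q ^ 2 <= #|X|)%N ->
    (4 * q * ((regularity_constant * q ^ r) ^ n * t) <= #|X|)%N ->
  exists (u : {ffun 'I_q -> X}) (W : 'I_q -> {set X}),
    [/\ injective u, forall i, (t <= #|W i|)%N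
      & forall phi : 'I_r -> 'I_q, injective phi -> Z [ffun l => u (phi l)] ->
        forall z : {ffun 'I_r -> X}, (forall l, z l \in W (phi l)) -> Z z].
Proof.
move=> r_gt0 q_gt0 le_q2 le_t.
have D_gt0 : (0 < D)%N by rewrite bin_gt0 leq_addr.
have X_gt0 : (0 < #|X|)%N by apply: leq_trans le_q2; rewrite muln_gt0 expn_gt0 q_gt0.
pose m := (4 * r * D * q ^ r)%N.
have m_gt0 : (0 < m)%N by rewrite !muln_gt0 r_gt0 D_gt0 expn_gt0 q_gt0.
have [TT [szTT algTT goodTT]] := exists_tests q m_gt0 (leqnn r).
pose y (phi : 'I_r -> 'I_q) (u : {ffun 'I_q -> X}) : {ffun 'I_r -> X} :=
  [ffun l => u (phi l)].
pose bad1 (phi : {ffun 'I_r -> 'I_q}) := [set u : {ffun 'I_q -> X} |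
  injectiveb phi && (Z (y phi u) && ~~ zero_upto TT r (y phi u))].
pose bad2 (p : 'I_q * 'I_q) := [set u : {ffun 'I_q -> X} |
  (p.1 != p.2) && (u p.1 == u p.2)].
pose bad3 i := [set u : {ffun 'I_q -> X} | #|hull TT (u i)| < t]%N.
have le1 : (4 * #|\bigcup_phi bad1 phi| <= #|X| ^ q)%N.
  apply: card_bigcup_le => phi; rewrite card_ffun !card_ord.
  (* m was chosen as 4 q ^ r times the number r D of cuts to be afforded. *)
  have [phi_inj|phi_ninj] := boolP (injectiveb phi); last first.
    rewrite (_ : bad1 phi = set0) ?cards0 ?muln0 //.
    by apply/setP => u; rewrite !inE (negPf phi_ninj).
  rewrite -(@leq_pmul2l (r * D)) ?muln_gt0 ?r_gt0 //.
  apply: leq_trans (goodTT _ (injectiveP _ phi_inj)).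
  rewrite leq_eqVlt; apply/orP; left; apply/eqP.
  rewrite (_ : [set u | _ & _] = bad1 phi); last first.
    by apply/setP => u; rewrite !inE phi_inj.
  by rewrite /m; ring.
have le2 : (4 * #|\bigcup_p bad2 p| <= #|X| ^ q)%N.
  apply: card_bigcup_le => -[i j]; rewrite card_prod !card_ord.
  have [->|ij] := eqVneq i j.
    rewrite (_ : bad2 _ = set0) ?cards0 ?muln0 //.
    by apply/setP => u; rewrite !inE eqxx.
  rewrite mulnA -[X in (_ <= X)%N]mul1n -[X in (_ ^ X)%N](card_ord q).
  apply: (@card_resample _ _ i) => u; rewrite mul1n.
  rewrite (_ : [set x | _] = [set u j]).
    by rewrite cards1 muln1; apply: leq_trans le_q2; rewrite mulnC.
  apply/setP => x; rewrite !inE /= ij !ffunE eqxx.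
  by rewrite [j == i]eq_sym (negPf ij).
have le3 : (4 * #|\bigcup_i bad3 i| <= #|X| ^ q)%N.
  apply: card_bigcup_le => i; rewrite card_ord.
  rewrite mulnA -[X in (_ <= X)%N]mul1n -[X in (_ ^ X)%N](card_ord q).
  apply: (@card_resample _ _ i) => u; rewrite mul1n.
  apply: leq_trans le_t; rewrite [(q * 4)%N]mulnC leq_mul2l; apply/orP; right.
  rewrite (_ : [set x | _] = [set x | #|hull TT x| < t]%N); last first.
    by apply/setP => x; rewrite !inE ffunE eqxx.
  apply: leq_trans (card_small_hull _ algTT) _.
  rewrite leq_mul2r; apply/orP; right.
  apply: leq_trans (bin_le_exp _ _) _.
  have [->|n_gt0] := posnP n; first by [].
  rewrite leq_exp2r // /regularity_constant mulnDl leq_add //.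
    by rewrite leq_pmulr // expn_gt0 q_gt0.
  apply: leq_trans (leq_mul szTT (leqnn d)) _.
  by rewrite leq_eqVlt; apply/orP; left; apply/eqP; rewrite /m; ring.
have [u] : exists u, u \notin (\bigcup_phi bad1 phi) :|: (\bigcup_p bad2 p)
    :|: (\bigcup_i bad3 i).
  by apply: exists_notin_setU3; rewrite card_ffun card_ord // expn_gt0 X_gt0.
rewrite !inE !negb_or => /andP [/andP [ok1 ok2] ok3].
exists u, (fun i => hull TT (u i)); split.
- move=> i j uij; apply/eqP/negPn/negP => ij; move/negP: ok2; apply.
  by apply/bigcupP; exists (i, j) => //; rewrite inE ij uij eqxx.
- move=> i; rewrite leqNgt; apply: contra ok3 => lt_t.
  by apply/bigcupP; exists i => //; rewrite inE.
move=> phi phi_inj Zu z hz.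
have : zero_upto TT r (y phi u).
  apply/negPn/negP => nzero; move/negP: ok1; apply.
  have phiE : y [ffun l => phi l] u = y phi u.
    by apply/ffunP => l; rewrite !ffunE.
  apply/bigcupP; exists [ffun l => phi l] => //; rewrite inE phiE Zu nzero.
  by rewrite !andbT; apply/injectiveP => l l'; rewrite !ffunE; exact: phi_inj.
by move/zero_uptoP; apply=> l; rewrite ltn_ord ffunE; exact: hz.
Qed.

End Homogeneous.

(** * Pairwise empty clusters *)

(** Counting pairs, some element x of S lies in at most k of the sets N i.
    Remove these indices, put x first, and iterate: k indices are lost for each
    index selected. *)
Lemma acyclic_selection (I : finType) (N : I -> {set I}) k b (S : {set I}) :
    (forall i, i \in S -> i \in N i) -> (forall i, i \in S -> #|N i| <= k)%N ->
    (k * b < #|S|)%N ->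
  exists v : 'I_b.+1 -> I,
    (forall a, v a \in S) /\ forall a a' : 'I_b.+1, (a < a')%N -> v a \notin N (v a').
Proof.
elim: b S => [|b IH] S self small big_S.
  have [x xS] : exists x, x \in S.
    by apply/set0Pn; rewrite -card_gt0; apply: leq_ltn_trans big_S.
  by exists (fun=> x); split=> // a a'; rewrite !ord1.
have [x xS x_in] : exists2 x, x \in S & (#|[set i in S | x \in N i]| <= k)%N.
  apply/exists_inP; apply: contraT => /exists_inPn large.
  have : (\sum_(x in S) #|[set i in S | x \in N i]| <= #|S| * k)%N.
    rewrite (eq_bigr (fun x => \sum_(i in S) (x \in N i)))%N => [|x _]; last first.
      rewrite -sum1dep_card [RHS]big_mkcond big_mkcondr.
      by rewrite [LHS]big_mkcond; apply: eq_bigr => i _; case: (i \in S).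
    rewrite exchange_big -sum_nat_const; apply: leq_sum => i iS.
    apply: leq_trans (small i iS); rewrite -big_mkcondr sum1dep_card.
    by apply/subset_leq_card/subsetP => x; rewrite inE => /andP [].
  rewrite leqNgt => /negP [].
  apply: (@leq_trans (\sum_(x in S) k.+1)%N).
    by rewrite sum_nat_const ltn_pmul2l //; apply: leq_ltn_trans big_S.
  by apply: leq_sum => i iS; rewrite ltnNge; exact: large.
have [|||v [vS vN]] := IH [set i in S | x \notin N i].
- by move=> i; rewrite inE => /andP [/self].
- by move=> i; rewrite inE => /andP [/small].
- have : (#|S| <= #|[set i in S | x \in N i]| + #|[set i in S | x \notin N i]|)%N.
    apply: leq_trans (leq_card_setU _ _); apply/subset_leq_card/subsetP => i iS.
    by rewrite !inE iS; case: (x \in N i).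
  move: big_S x_in; rewrite mulnS.
  move: #|S| #|[set i in S | x \in N i]| #|[set i in S | x \notin N i]|.
  lia.
exists (fun a => if unlift ord0 a is Some a' then v a' else x); split.
  move=> a; case: unliftP => [a' _|_ //].
  by have := vS a'; rewrite inE => /andP [].
move=> a a'; case: (unliftP ord0 a') => [c' ->|->]; last by rewrite ltn0.
case: (unliftP ord0 a) => [c ->|-> _]; first by rewrite !lift0 ltnS; exact: vN.
by have := vS c'; rewrite inE => /andP [].
Qed.

Section Clusters.
Variables (K : fieldType) (n : nat) (X : finType) (pt : X -> 'I_n -> K).
Variables (r d : nat) (Z : pred {ffun 'I_r -> X}).
Hypothesis algZ : forall v k, algebraic_set pt d [set x | Z (update v k x)].
Variables (I : finType) (W : I -> {set X}).

(** Among the tuples at which Z fails, with all repeated indices equal to i, and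
    with i present, take one that meets the largest number of clusters.  Its
    indices are not distinct, so i is repeated; freeing one coordinate in W i
    gives A, since a point of a new cluster outside A would extend the
    tuple. *)
Lemma cluster_test (S : {set I}) i (z0 : {ffun 'I_r -> X}) : (0 < r)%N ->
    (forall phi : 'I_r -> I, injective phi -> (forall l, phi l \in S) ->
       forall z : {ffun 'I_r -> X}, (forall l, z l \in W (phi l)) -> Z z) ->
    i \in S -> (forall l, z0 l \in W i) -> ~~ Z z0 ->
  exists (A : {set X}) (b : X) (N : {set I}),
    [/\ algebraic_set pt d A, b \in W i, b \notin A, (i \in N) && (#|N| <= r - 1)%N
      & forall j, j \in S -> j \notin N -> W j \subset A].
Proof.
move=> r_gt0 emptyS iS z0W nZ0.
pose state (p : {ffun 'I_r -> I} * {ffun 'I_r -> X}) :=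
  [&& [forall l, p.1 l \in S], [forall l, p.2 l \in W (p.1 l)], ~~ Z p.2,
      [forall l, forall l', (l != l') && (p.1 l == p.1 l') ==> (p.1 l == i)]
    & i \in [set p.1 l | l : 'I_r]].
have state0 : state ([ffun=> i], z0).
  apply/and5P; split=> //=.
  - by apply/forallP => l; rewrite ffunE.
  - by apply/forallP => l; rewrite ffunE.
  - by apply/forallP => l; apply/forallP => l'; rewrite !ffunE eqxx implybT.
  - by apply/imsetP; exists (Ordinal r_gt0) => //; rewrite ffunE.
pose spread (p : {ffun 'I_r -> I} * {ffun 'I_r -> X}) := #|[set p.1 l | l : 'I_r]|.
case: (arg_maxnP spread state0) => -[phi z] /=.
case/and5P => /= /forallP phiS /forallP zW nZ /forallP coll iphi maximal.
have phi_ninj : ~ injective phi.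
  by move=> phi_inj; move/negP: nZ; apply; exact: emptyS phi_inj phiS _ zW.
have [l [l' [ll' phil phil']]] : exists l l', [/\ l != l', phi l = i & phi l' = i].
  have /injectivePn [l [l' ll' eq_phi]] : ~~ injectiveb phi.
    by apply/injectiveP.
  have := coll l => /forallP /(_ l'); rewrite ll' eq_phi eqxx /= => /eqP <-.
  by exists l, l'.
exists [set x | Z (update z l x)], (z l), [set phi l | l : 'I_r]; split.
- exact: algZ.
- by rewrite -phil.
- by rewrite inE update_id.
- rewrite iphi /=.
  have : (#|[set phi l | l : 'I_r]| < r)%N.
    rewrite -[X in (_ < X)%N]card_ord ltn_neqAle.
    rewrite (leq_trans (leq_imset_card _ _)) ?max_card // andbT.
    by apply/negP => /imset_injP inj; apply: phi_ninj => a a'; apply: inj.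
  by move=> lt_r; rewrite -ltnS subn1 prednK.
move=> j jS jphi; apply/subsetP => x xW; rewrite inE; apply: contraT => nZx.
have := maximal (update phi l j, update z l x); rewrite /spread /=.
have -> : state (update phi l j, update z l x).
  apply/and5P; split=> //=.
  - by apply/forallP => a; rewrite ffunE; case: eqP.
  - by apply/forallP => a; rewrite !ffunE; case: eqP.
  - apply/forallP => a; apply/forallP => a'; rewrite !ffunE; apply/implyP.
    have [->|al] := eqVneq a l.
      have [//|a'l] := eqVneq a' l.
      by case/andP => _ /eqP ja; move/negP: jphi; case; apply/imsetP; exists a'.
    have [_|a'l] := eqVneq a' l.
      by case/andP => _ /eqP ja; move/negP: jphi; case; apply/imsetP; exists a.
    by have /forallP/(_ a')/implyP := coll a.
  - apply/imsetP; exists l' => //; rewrite ffunE eq_sym (negPf ll') //.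
move=> /(_ isT); rewrite leqNgt => /negP []; apply: proper_card; apply/properP; split.
  apply/subsetP => _ /imsetP [a _ ->]; apply/imsetP.
  have [->|al] := eqVneq a l.
    by exists l' => //; rewrite ffunE eq_sym (negPf ll') phil.
  by exists a => //; rewrite ffunE (negPf al).
by exists j => //; apply/imsetP; exists l => //; rewrite ffunE eqxx.
Qed.

(** Otherwise [acyclic_selection] picks D + 1 of the tests given by
    [cluster_test], and these are triangular at the points b of the clusters. *)
Lemma card_empty_clusters (S : {set I}) : (0 < r)%N ->
    (forall i, i \in S ->
       exists2 z : {ffun 'I_r -> X}, forall l, z l \in W i & ~~ Z z) ->
    (forall phi : 'I_r -> I, injective phi -> (forall l, phi l \in S) ->
       forall z : {ffun 'I_r -> X}, (forall l, z l \in W (phi l)) -> Z z) ->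
  (#|S| <= (r - 1) * 'C(n + d, n))%N.
Proof.
move=> r_gt0 full emptyS; rewrite leqNgt; apply/negP => large.
have [s0 s0S] : exists s, s \in S.
  by apply/set0Pn; rewrite -card_gt0; apply: leq_ltn_trans large.
have test i : exists p : {set X} * X * {set I}, i \in S ->
    [/\ algebraic_set pt d p.1.1, p.1.2 \in W i, p.1.2 \notin p.1.1,
        (i \in p.2) && (#|p.2| <= r - 1)%N
      & forall j, j \in S -> j \notin p.2 -> W j \subset p.1.1].
  have [iS|niS] := boolP (i \in S).
    have [z zW nZ] := full _ iS.
    have [A [b [N [h1 h2 h3 h4 h5]]]] := cluster_test r_gt0 emptyS iS zW nZ.
    by exists (A, b, N).
  (* Outside S any value will do, but X has to be shown nonempty. *)
  have [z zW nZ] := full _ s0S.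
  by exists (set0, z (Ordinal r_gt0), set0).
have [p pP] := fin_all_exists test.
have [i iS|i iS|v [vS vN]] := @acyclic_selection _ (fun i => (p i).2) _ _ _ _ _ large.
- by have [_ _ _ /andP []] := pP i iS.
- by have [_ _ _ /andP []] := pP i iS.
have : (#|{: 'I_('C(n + d, n)).+1}| <= 'C(n + d, n))%N.
  apply: (@algebraic_set_dim _ _ _ pt d _
    (fun a : 'I_('C(n + d, n)).+1 => 'C(n + d, n) - a)%N
    (fun a => (p (v a)).1.1) (fun a => (p (v a)).1.2)) => [a|a|a a' aa' le_a].
  - by have [] := pP _ (vS a).
  - by have [] := pP _ (vS a).
  have lt_a : (a' < a)%N.
    rewrite ltn_neqAle; apply/andP; split; first by rewrite eq_sym.
    by have := ltn_ord a; have := ltn_ord a'; lia.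
  have [_ _ _ _ sub] := pP _ (vS a); have [_ bW _ _ _] := pP _ (vS a').
  by apply: (subsetP (sub _ (vS a') (vN _ _ lt_a))).
by rewrite card_ord ltnn.
Qed.
End Clusters.

(** * From hypergraphs to zero patterns *)

(** Substituting polynomials of degree at most 1 does not raise the degree. *)
Lemma msize_comp_affine (K : fieldType) n k d (p : {mpoly K[k]})
    (lq : k.-tuple {mpoly K[n]}) :
    (msize p <= d.+1)%N -> (forall i, msize (tnth lq i) <= 2)%N ->
  (msize (p \mPo lq) <= d.+1)%N.
Proof.
move=> szp szlq.
have szX e i : (msize (tnth lq i ^+ e) <= e.+1)%N.
  elim: e => [|e IH]; first by rewrite expr0 msize1.
  by rewrite exprS; apply: (@msizeM_degree _ _ 1 e).
have szprod (m : 'X_{1..k}) (s : seq 'I_k) :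
    (msize (\prod_(i <- s) tnth lq i ^+ m i) <= (\sum_(i <- s) m i).+1)%N.
  elim: s => [|i s IH]; first by rewrite !big_nil msize1.
  by rewrite !big_cons; exact: msizeM_degree.
rewrite comp_mpolyEX big_seq.
elim/big_rec: _ => [|m q mp le_q]; first by rewrite msize0.
apply: leq_trans (mmeasureD_le _ _ _) _; rewrite geq_max le_q andbT.
apply: leq_trans (msizeZ_le _ _) _; rewrite comp_mpolyX.
apply: leq_trans (szprod m _) _; rewrite -mdegE.
exact: leq_trans (msize_mdeg_lt mp) szp.
Qed.

Section Bridge.
Variables (K : fieldType) (r n d : nat) (V : {fset 'rV[K]_n}).
Variable f : {mpoly K[r * n]}.
Hypothesis szf : (msize f <= d.+1)%N.

Definition coordinates (x : V) (j : 'I_n) : K := val x ord0 j.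

Definition vanishing (v : {ffun 'I_r -> V}) : bool :=
  eval_vectors f (fun l => val (v l)) == 0.

(** Freezing all vectors but the k-th amounts to composing f with a tuple of
    variables and constants. *)
Lemma algebraic_vanishing v k :
  algebraic_set coordinates d [set x | vanishing (update v k x)].
Proof.
have /fin_all_exists [lq lqP] (i : 'I_(r * n)) : exists p : {mpoly K[n]},
    (msize p <= 2)%N /\ forall x,
    p.@[coordinates x] = mxvec (\matrix_(l < r) val (update v k x l)) 0 i.
  case/mxvec_indexP: i => l j.
  have [->|lk] := eqVneq l k.
    exists 'X_j; split; first by rewrite msizeX mdeg1.
    by move=> x; rewrite mevalXU mxvecE mxE ffunE eqxx.
  exists (val (v l) ord0 j)%:MP; split; first by rewrite msizeC; case: eqP.
  by move=> x; rewrite mevalC mxvecE mxE ffunE (negPf lk).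
have evalE x : (f \mPo [tuple lq i | i < r * n]).@[coordinates x] =
    eval_vectors f (fun l => val (update v k x l)).
  rewrite comp_mpoly_meval; apply: meval_eq => i.
  by rewrite tnth_mktuple; case: (lqP i).
move=> x; rewrite inE => nZ; exists (f \mPo [tuple lq i | i < r * n]); split.
- apply: msize_comp_affine => // i; by rewrite tnth_mktuple; case: (lqP i).
- by rewrite evalE.
- by move=> w; rewrite inE evalE => /eqP.
Qed.
End Bridge.

Local Open Scope fset_scope.
Local Open Scope ring_scope.

Lemma fset_enum_injection (T : choiceType) (e : {fset T}) r : #|` e| = r ->
  exists v : 'I_r -> T, [/\ injective v, forall i, v i \in e & [fset v i | i in 'I_r] = e].
Proof.
move=> <-; pose t := in_tuple (enum_fset e); exists (tnth t); split.
- by apply/tuple_uniqP; exact: fset_uniq.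
- by move=> i; exact: mem_tnth.
apply/fsetP => x; apply/imfsetP/idP => [[i _ ->]|xe]; first exact: mem_tnth.
by have /tnthP [i ->] : x \in t by []; exists i.
Qed.

(** Either f vanishes on all tuples from the cluster of some sampled vertex,
    which is then independent, or the sampled vertices have bounded
    independence number by [card_empty_clusters]. *)
Lemma independent_or_bounded_independence (K : fieldType) (r n d q t : nat)
    (H : hypergraph 'rV[K]_n) :
    (0 < r)%N -> (0 < q)%N -> strongly_algebraic r d H ->
    (4 * q ^ 2 <= #|` vertices H|)%N ->
    (4 * q * ((regularity_constant n r d * q ^ r) ^ n * t) <= #|` vertices H|)%N ->
  (exists A, independent r H A /\ (t <= #|` A|)%N) \/
  (exists A : {fset 'rV[K]_n}, [/\ A `<=` vertices H, #|` A| = q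
    & forall B, B `<=` A -> independent r H B ->
        (#|` B| <= (r - 1) * 'C(n + d, d))%N]).
Proof.
move=> r_gt0 q_gt0 [f [szf _ edgeP]]; rewrite cardfE => le_q2 le_t.
set V := vertices H in edgeP le_q2 le_t *.
have algZ := algebraic_vanishing (V := V) szf.
set Z := vanishing f in algZ.
have edge_vanish (v : {ffun 'I_r -> V}) : injective v ->
    ([fset val (v i) | i in 'I_r] \notin edges H) = Z v.
  move=> v_inj; have [] := edgeP (fun i => val (v i)).
  - by move=> i j /val_inj /v_inj.
  - by move=> i; exact: fsvalP.
  rewrite /Z /vanishing; case: (_ \in edges H) => [/(_ isT) /eqP /negPf -> //|_].
  by case: eqP => // nz /(_ nz).
have [u [W [u_inj W_t uW]]] := homogeneous_sample algZ r_gt0 q_gt0 le_q2 le_t.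
have [|/existsPn full] :=
    boolP [exists i, [forall z : {ffun 'I_r -> V}, [forall l, z l \in W i] ==> Z z]].
  case/existsP => i /forallP Wi; left; exists [fset val x | x in W i].
  split; last by rewrite card_imfset //=; [rewrite -cardE | exact: val_inj].
  split; first by apply/fsubsetP => _ /imfsetP [x _ ->]; exact: fsvalP.
  move=> e /fsubsetP eA e_r; have [v [v_inj ve <-]] := fset_enum_injection e_r.
  have /fin_all_exists [w wP] (l : 'I_r) : exists x : V, x \in W i /\ v l = val x.
    by have /eA /imfsetP [x /= xW ->] := ve l; exists x.
  have -> : [fset v l | l in 'I_r] = [fset val ([ffun l => w l] l) | l in 'I_r].
    by apply: eq_imfset => // l; rewrite ffunE; case: (wP l).
  rewrite edge_vanish => [|l l']; last first.
    by rewrite !ffunE => ww; apply: v_inj; rewrite !(proj2 (wP _)) ww.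
  apply: (implyP (Wi _)); apply/forallP => l; rewrite ffunE; by case: (wP l).
right; exists [fset val (u i) | i in 'I_q]; split.
- by apply/fsubsetP => _ /imfsetP [x _ ->]; exact: fsvalP.
- rewrite card_imfset /=; last by move=> i j /val_inj /u_inj.
  by rewrite size_enum_ord.
move=> B /fsubsetP BA [_ indepB].
pose S := [set i | val (u i) \in B].
have -> : #|` B| = #|S|.
  have -> : B = [fset val (u i) | i in S].
    apply/fsetP => x; apply/idP/imfsetP => [xB|[i /= iS ->]].
      by have /imfsetP [i _ xE] := BA _ xB; exists i => //=; rewrite inE -xE.
    by move: iS; rewrite inE.
  rewrite card_imfset /=; last by move=> i j /val_inj /u_inj.
  by rewrite -cardE.
rewrite -[X in 'C(_, X)](addKn n) bin_sub ?leq_addr //.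
apply: (card_empty_clusters algZ (W := W)) => // [i _|phi phi_inj phiS].
  have /forallPn [z] := full i; rewrite negb_imply => /andP [/forallP zW nZ].
  by exists z.
apply: uW => //; rewrite -edge_vanish; last first.
  by move=> l l'; rewrite !ffunE => /u_inj /phi_inj.
apply: indepB.
  apply/fsubsetP => _ /imfsetP [l _ ->]; rewrite ffunE.
  by have := phiS l; rewrite inE.
rewrite card_imfset /=; first by rewrite size_enum_ord.
by move=> l l' /val_inj; rewrite !ffunE => /u_inj /phi_inj.
Qed.

(** * Cliques and independent sets in small and induced hypergraphs *)

Lemma clique0 (T : choiceType) r (H : hypergraph T) : (0 < r)%N -> clique r H fset0.
Proof.
move=> r_gt0; split; first exact: fsub0set.
move=> e; rewrite fsubset0 => /eqP ->; rewrite cardfs0 => r0.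
by rewrite -r0 in r_gt0.
Qed.

Lemma singleton_homogeneous (T : choiceType) r (H : hypergraph T) x :
  (0 < r)%N -> x \in vertices H ->
  clique r H [fset x] \/ independent r H [fset x].
Proof.
move=> r_gt0 xV.
have sub1 (e : {fset T}) : e `<=` [fset x] -> #|` e| = r -> e = [fset x].
  rewrite fsubset1 => /orP [/eqP // | /eqP ->]; rewrite cardfs0 => r0.
  by rewrite -r0 in r_gt0.
have [xE|xE] := boolP ([fset x] \in edges H); [left|right]; split.
- by rewrite fsub1set.
- by move=> e ex er; rewrite (sub1 e ex er).
- by rewrite fsub1set.
- by move=> e ex er; rewrite (sub1 e ex er).
Qed.

Lemma singleton_independent (T : choiceType) r (H : hypergraph T) x :
  (1 < r)%N -> x \in vertices H -> independent r H [fset x].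
Proof.
move=> r_gt1 xV; split; first by rewrite fsub1set.
move=> e /fsubset_leq_card; rewrite cardfs1 => le1 er.
by move: r_gt1; rewrite -er ltnNge le1.
Qed.

Lemma restriction_edges_sub (T : choiceType) (H : hypergraph T) (A : {fset T}) :
  [fset e in edges H | e `<=` A] `<=` fpowerset A.
Proof. by apply/fsubsetP => e; rewrite !inE fpowersetE => /andP []. Qed.

Definition restriction (T : choiceType) (H : hypergraph T) (A : {fset T}) :
  hypergraph T := Hypergraph (restriction_edges_sub H A).

Lemma restriction_induced (T : choiceType) (H : hypergraph T) A :
  A `<=` vertices H -> induced_subhypergraph (restriction H A) H.
Proof. by []. Qed.

Lemma clique_induced (T : choiceType) r (H H' : hypergraph T) A :
  induced_subhypergraph H' H -> clique r H' A -> clique r H A.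
Proof.
move=> [sV sE] [AV Acl]; split; first exact: fsubset_trans AV sV.
by move=> e eA er; have := Acl e eA er; rewrite sE !inE => /andP [].
Qed.

Lemma independent_induced (T : choiceType) r (H H' : hypergraph T) A :
  induced_subhypergraph H' H -> independent r H' A -> independent r H A.
Proof.
move=> [sV sE] [AV Aind]; split; first exact: fsubset_trans AV sV.
move=> e eA er; have := Aind e eA er; rewrite sE !inE negb_and.
by rewrite (fsubset_trans eA AV) orbF.
Qed.

(** * Choice of the sample size and conclusion *)

(** Take q = floor (c N ^ gamma) and t = floor (N ^ (1 - beta)) + 1.  As
    1 + r n <= n (r + 1), the power q ^ (1 + r n) in the last bound is at
    most c ^ n N ^ beta, and c = 1 / (8 C) absorbs the constants. *)
Lemma sample_size (R : realType) (r n C N : nat) (beta : R) :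
    (0 < r)%N -> (0 < n)%N -> (0 < C)%N -> 0 < beta -> beta <= 1 -> (0 < N)%N ->
    let gamma := beta / (n * r.+1)%:R in
    let c := (8 * C)%:R^-1 : R in
    1 <= c * powR N%:R gamma ->
  exists q t : nat, [/\ (0 < q)%N, c / 2 * powR N%:R gamma <= q%:R,
    powR N%:R (1 - beta) <= t%:R, (4 * q ^ 2 <= N)%N
    & (4 * q * ((C * q ^ r) ^ n * t) <= N)%N].
Proof.
move=> r_gt0 n_gt0 C_gt0 beta_gt0 beta_le1 N_gt0 gamma c big_N.
set y := c * _ in big_N.
have y_ge0 : 0 <= y by apply: le_trans big_N.
have N_ge1 : 1 <= N%:R :> R by rewrite ler1n.
pose x : R := powR N%:R (1 - beta).
have x_ge1 : 1 <= x.
  by rewrite /x -[leLHS](powRr0 N%:R); apply: ler_powR; rewrite ?subr_ge0.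
have /andP [q_le q_gt] := truncn_itv y_ge0.
have /andP [t_le t_gt] := truncn_itv (le_trans ler01 x_ge1).
set q := Num.truncn y in q_le q_gt; set t := Num.truncn x in t_le t_gt.
have q_gt0 : (0 < q)%N by rewrite truncn_gt0.
have c_gt0 : 0 < c by rewrite invr_gt0 ltr0n muln_gt0 C_gt0.
have c_le1 : c <= 1 by rewrite invf_le1 ?ltr0n ?ler1n muln_gt0 C_gt0.
have le_qt : (4 * q * ((C * q ^ r) ^ n * t.+1) <= N)%N.
  rewrite -(ler_nat R) !natrM natrX natrM natrX.
  have yE : y ^+ (n * r.+1) = c ^+ (n * r.+1) * powR N%:R beta.
    rewrite /y exprMn -[X in _ * X]powR_mulrn ?powR_ge0 // -powRrM.
    by rewrite divfK // pnatr_eq0 muln_eq0 negb_or -!lt0n n_gt0.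
  have le_q : q%:R ^+ (1 + r * n) <= c ^+ n * powR N%:R beta.
    apply: (@le_trans _ _ (q%:R ^+ (n * r.+1))).
      by apply: ler_weXn2l; [rewrite ler1n | nia].
    apply: (@le_trans _ _ (y ^+ (n * r.+1))).
      by rewrite lerXn2r // nnegrE.
    rewrite yE ler_wpM2r ?powR_ge0 //.
    by apply: ler_wiXn2l; rewrite ?(ltW c_gt0) //; nia.
  have le_t : t.+1%:R <= 2 * x by rewrite -natr1; lra.
  have cC : 8%:R * (C%:R ^+ n * c ^+ n) <= 1 :> R.
    rewrite -exprMn (_ : C%:R * c = 8%:R^-1); last first.
      by rewrite /c natrM invfM mulrCA mulfV ?mulr1 // pnatr_eq0 -lt0n.
    rewrite -(prednK n_gt0) exprS mulrA mulfV ?pnatr_eq0 // mul1r.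
    by apply: exprn_ile1; rewrite ?invr_ge0 ?invf_le1 ?ltr0n ?ler1n.
  rewrite exprMn -exprM.
  have -> : 4%:R * q%:R * (C%:R ^+ n * q%:R ^+ (r * n) * t.+1%:R) =
      4%:R * C%:R ^+ n * (q%:R ^+ (1 + r * n) * t.+1%:R) :> R.
    by rewrite exprD expr1; ring.
  apply: (@le_trans _ _ (4%:R * C%:R ^+ n * (c ^+ n * powR N%:R beta * (2 * x)))).
    by rewrite ler_wpM2l ?mulr_ge0 ?exprn_ge0 // ler_pM ?exprn_ge0.
  have xN : powR N%:R beta * x = N%:R :> R.
    have beta1 : beta + (1 - beta) = 1 by rewrite addrC subrK.
    by rewrite -powRD beta1 ?oner_eq0 // powRr1 ?ler0n.
  have -> : 4%:R * C%:R ^+ n * (c ^+ n * powR N%:R beta * (2 * x)) =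
      8%:R * (C%:R ^+ n * c ^+ n) * (powR N%:R beta * x) by ring.
  by rewrite xN ler_piMl.
exists q, t.+1; split=> //; last 1 first.
- apply: leq_trans le_qt; rewrite expnS expn1 mulnA leq_mul2l; apply/orP; right.
  rewrite -[X in (X <= _)%N]muln1 leq_mul //.
  rewrite expnMn -expnM -[X in (X <= _)%N]mul1n leq_mul ?expn_gt0 ?C_gt0 //.
  by rewrite -[X in (X <= _)%N]expn1 leq_pexp2l // muln_gt0 r_gt0.
- rewrite mulrAC -/y; move: q_gt; rewrite -natr1.
  have : 1 <= q%:R :> R by rewrite ler1n.
  lra.
- exact: ltW.
Qed.

Theorem theorem1p6 (R : realType) (r : nat) (hr : (0 < r)%N) :
  exists delta : R, 0 < delta /\
  forall (n d : nat) (c alpha beta : R),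
    (0 < n)%N -> (0 < d)%N -> 0 < c -> 0 < alpha -> 0 < beta ->
    (* for r = 1 and beta > 1 the claim fails, e.g. for complete hypergraphs *)
    (1 < r)%N \/ beta <= 1 ->
  exists c1 c2 : R, 0 < c1 /\ 0 < c2 /\
  forall F : hypergraph_family n,
    hereditary F ->
    (forall (K : fieldType) (H : hypergraph 'rV[K]_n), F K H ->
       uniform r H /\ strongly_algebraic r d H) ->
    (forall (K : fieldType) (H : hypergraph 'rV[K]_n), F K H ->
       (exists A, clique r H A /\
          c * powR #|` vertices H|%:R alpha <= #|` A|%:R) \/
       (exists A, independent r H A /\
          #|` A| = ((r - 1) * 'C(n + d, d) + 1)%N)) ->
    forall (K : fieldType) (H : hypergraph 'rV[K]_n), F K H ->
      (exists A, clique r H A /\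
         c1 * powR #|` vertices H|%:R (delta * alpha * beta / n%:R)
           <= #|` A|%:R) \/
      (exists A, independent r H A /\
         c2 * powR #|` vertices H|%:R (1 - beta) <= #|` A|%:R).
Proof.
exists r.+1%:R^-1; split; first by rewrite invr_gt0.
move=> n d c alpha beta n_gt0 _ c_gt0 alpha_gt0 beta_gt0 r_beta.
pose gamma : R := beta / (n * r.+1)%:R.
have gamma_gt0 : 0 < gamma by rewrite divr_gt0 // ltr0n muln_gt0 n_gt0.
have -> : r.+1%:R^-1 * alpha * beta / n%:R = gamma * alpha.
  by rewrite /gamma natrM invfM; move: r.+1%:R^-1 n%:R^-1 => a b; ring.
pose C := regularity_constant n r d.
have C_gt0 : (0 < C)%N by rewrite /C /regularity_constant addn_gt0 n_gt0.
pose e : R := (8 * C)%:R^-1.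
have e_gt0 : 0 < e by rewrite invr_gt0 ltr0n muln_gt0 C_gt0.
have e_le1 : e <= 1 by rewrite invf_le1 ?ltr0n ?ler1n muln_gt0 C_gt0.
pose c1 := Num.min 1 c * powR (e / 2) alpha; pose c2 := powR e gamma^-1.
have e2_gt0 : 0 < e / 2 by rewrite divr_gt0.
exists c1, c2; split; first by rewrite mulr_gt0 ?powR_gt0 // lt_min ltr01.
split; first by rewrite powR_gt0.
have powR_le1 (b a : R) : 0 <= b -> b <= 1 -> 0 <= a -> powR b a <= 1.
  move=> b_ge0 b_le1 a_ge0; have -> : 1 = powR 1 a :> R by rewrite powR1.
  by apply: ge0_ler_powR; rewrite ?nnegrE.
have c2_le1 : c2 <= 1 by rewrite powR_le1 ?(ltW e_gt0) ?invr_ge0 ?(ltW gamma_gt0).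
move=> F hered algF ramseyF K H FH.
set V := vertices H; pose N := #|` V|; rewrite -/N.
have [N0|N_gt0] := posnP N.
  left; exists fset0; split; first exact: clique0.
  by rewrite N0 powR0 ?mulr0 // mulf_neq0 ?gt_eqF.
have [x xV] : exists x, x \in V by apply/fset0Pn; rewrite -cardfs_gt0.
have N_ge1 : 1 <= N%:R :> R by rewrite ler1n.
have [beta_le1|beta_gt1] := leP beta 1; last first.
  (* N ^ (1 - beta) is at most 1, and a vertex is independent when r > 1. *)
  right; exists [fset x]; split.
    by apply: singleton_independent => //; case: r_beta => //; rewrite leNgt beta_gt1.
  rewrite cardfs1 -[leRHS]mulr1 ler_pM ?powR_ge0 //.
  by rewrite -[leRHS](powRr0 N%:R); apply: ler_powR; rewrite // subr_le0 ltW.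
have [small|large] := ltP (e * powR N%:R gamma) 1.
  (* N is bounded, and c1, c2 are small enough for a single vertex to do. *)
  have bound a : 0 <= a -> powR e a * powR (powR N%:R gamma) a <= 1.
    move=> a_ge0; rewrite -powRM ?powR_ge0 ?(ltW e_gt0) //.
    by rewrite powR_le1 ?mulr_ge0 ?powR_ge0 ?(ltW e_gt0) ?(ltW small).
  case: (singleton_homogeneous hr xV) => hx; [left|right]; exists [fset x];
    split=> //; rewrite cardfs1.
    apply: le_trans (bound alpha (ltW alpha_gt0)); rewrite powRrM ler_wpM2r ?powR_ge0 //.
    rewrite /c1 -[leRHS]mul1r ler_pM ?powR_ge0 ?le_min ?ler01 ?(ltW c_gt0) ?ge_min ?lexx //.
    rewrite ge0_ler_powR ?nnegrE ?(ltW alpha_gt0) ?(ltW e_gt0) ?(ltW e2_gt0) //; lra.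
  apply: le_trans (bound gamma^-1 _); last by rewrite invr_ge0 ltW.
  rewrite ler_wpM2l ?powR_ge0 // -powRrM mulfV ?gt_eqF // ler_powR //; lra.
have [q [t [q_gt0 q_large t_large le_q le_t]]] :=
  sample_size hr n_gt0 C_gt0 beta_gt0 beta_le1 N_gt0 large.
have [_ algH] := algF K H FH.
have [[A [indA tA]]|[A [AV Aq Aind]]] :=
  independent_or_bounded_independence hr q_gt0 algH le_q le_t.
  right; exists A; split=> //; apply: le_trans (_ : t%:R <= _); last by rewrite ler_nat.
  by apply: le_trans t_large; rewrite ler_piMl ?powR_ge0.
have indH := restriction_induced AV.
have [[B [clB cB]]|[B [indB sB]]] := ramseyF _ _ (hered _ _ _ FH indH).
  left; exists B; split; first exact: clique_induced clB.
  apply: le_trans cB; rewrite /= Aq /c1 powRrM -mulrA.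
  rewrite -powRM ?powR_ge0 ?(ltW e2_gt0) //.
  rewrite ler_pM ?powR_ge0 ?le_min ?ler01 ?(ltW c_gt0) ?ge_min ?lexx ?orbT //.
  apply: ge0_ler_powR; rewrite ?nnegrE ?ler0n ?(ltW alpha_gt0) //.
  by rewrite mulr_ge0 ?powR_ge0 ?(ltW e2_gt0).
have := Aind B (proj1 indB) (independent_induced indH indB).
by rewrite sB addn1 ltnn.
Qed.
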